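(* Let $K$ be a field of characteristic zero. The following two statements are equivalent. (a) The Jacobian conjecture holds for all $n\ge 1$: for every $n\ge1$, every polynomial map $F=(F_1,\dots,F_n)$ of $K^n$ with $\det(\partial F_i/\partial z_j)\equiv 1$ is an automorphism of $K^n$ (i.e. has a polynomial inverse). (b) For every $n\ge1$ and every $H=(H_1,\dots,H_n)\in K[z]^{n}$ (with $z=(z_1,\dots,z_n)$) satisfying $o(H)\ge 2$, the differential operator $\Lambda=\sum_{i=1}^n\partial_{\xi_i}\partial_{z_i}$ and the polynomial $P(\xi,z)=\langle \xi,H(z)\rangle=\sum_{i=1}^n\xi_iH_i(z)\in K[\xi,z]$ satisfy the following: if $\Lambda^m(P^m)=0$ for all $m\ge1$, then $\Lambda^m(P^{m+1})=0$ for all sufficiently large $m$.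
   Context: $\xi=(\xi_1,\dots,\xi_n)$ and $z=(z_1,\dots,z_n)$ are $2n$ commuting free variables over $K$. For a tuple $H$ of polynomials, $o(H)$ is the minimum of the orders of the $H_i$, i.e. the lowest degree in $z$ of a nonzero term (with $o(0)=+\infty$). *)

(* Defs.v *)
From HB Require Import structures.
From mathcomp Require Import all_boot all_order all_algebra.
From mathcomp Require Export mpoly.

Set Implicit Arguments.
Unset Strict Implicit.
Unset Printing Implicit Defensive.

Import GRing.Theory.
Local Open Scope ring_scope.

Section PolynomialMaps.

Context {K : fieldType}.

(* K is infinite in characteristic zero, so a polynomial map of K^n is the
   same thing as its tuple of component polynomials. *)
Definition polymap n := n.-tuple {mpoly K[n]}.

Definition polymap_id n : polymap n := [tuple 'X_i | i < n].

Definition polymap_comp n (F G : polymap n) : polymap n :=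
  [tuple tnth F i \mPo G | i < n].

Definition polymap_automorphism n (F : polymap n) : Prop :=
  exists G : polymap n,
    polymap_comp F G = polymap_id n /\ polymap_comp G F = polymap_id n.

Definition jacobian n (F : polymap n) : 'M[{mpoly K[n]}]_n :=
  \matrix_(i < n, j < n) mderiv j (tnth F i).

End PolynomialMaps.

(* Orders live in nat extended by +oo, encoded as [option nat] with
   [None] = +oo. *)
Definition xmin (a b : option nat) : option nat :=
  match a, b with
  | Some m, Some n => Some (minn m n)
  | Some m, None => Some m
  | None, _ => b
  end.

Definition leq_xnat (k : nat) (a : option nat) : bool :=
  if a is Some m then (k <= m)%N else true.

Section Orders.

Context {K : fieldType}.

Definition mporder n (p : {mpoly K[n]}) : option nat :=
  \big[xmin/None]_(m <- msupp p) Some (mdeg m).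

Definition tuple_order n k (H : k.-tuple {mpoly K[n]}) : option nat :=
  \big[xmin/None]_(i < k) mporder (tnth H i).

End Orders.

(* K[xi, z] is {mpoly K[n + n]}: the first n variables are the xi_i, the last
   n variables are the z_i. *)
Section XiZ.

Context {K : fieldType} {n : nat}.

Definition xi (i : 'I_n) : {mpoly K[n + n]} := 'X_(lshift n i).

Definition zvars : n.-tuple {mpoly K[n + n]} := [tuple 'X_(rshift n i) | i < n].

Definition Lambda (p : {mpoly K[n + n]}) : {mpoly K[n + n]} :=
  \sum_(i < n) mderiv (lshift n i) (mderiv (rshift n i) p).

Definition xi_pairing (H : n.-tuple {mpoly K[n]}) : {mpoly K[n + n]} :=
  \sum_(i < n) xi i * (tnth H i \mPo zvars).

End XiZ.

(* Main.v *)
From HB Require Import structures.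
Require Import Defs.
From mathcomp Require Import all_boot all_order all_algebra.

(** Write T_m(u) for the sum of d_{i_1} ... d_{i_m} (u H_{i_1} ... H_{i_m})
    over all sequences of m indices ([iterdiv]).  Since P is linear in xi with
    coefficients H_i, one application of Lambda to P^m u(z) gives
    m * sum_i d_{z_i} (P^(m-1) u H_i); by induction Lambda^m(P^m) = m! T_m(1)
    and Lambda^m(P^(m+1)) = (m+1)! sum_j xi_j T_m(H_j).  So the condition on H
    and its conclusion are the vanishing of T_m(1) for all m >= 1, and that of
    all T_m(H_j) for large m.

    The T_m are the Taylor coefficients of an inverse map.  Let t be a new
    variable, G the power series in t with G = z + t H(G), that is the inverse
    of the pencil z - tH, and E(u) = u(G) det(dG/dz).  The velocity of G is
    dG/dt = (dG/dz) H(G), whence the conservation law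
    dE(u)/dt = sum_i d_i E(u H_i), and as E(u) = u at t = 0 this gives the
    Abhyankar-Gurjar formula E(u) = sum_m (t^m / m!) T_m(u)
    ([coef_transport]).  In place of power series, polynomials in t are used,
    taken modulo t^N for every N; G exists modulo t^N by iteration and is
    unique because u -> t H(u) is contracting.

    With u = 1 the formula yields: T_m(1) = 0 for all m >= 1 iff
    det(dG/dz) = 1 iff det(1 - t dH/dz) = 1 ([iterdiv1_eq0],
    [det_pencil_eq1]).  In that case H_j(G) = sum_m (t^m / m!) T_m(H_j), so
    T_m(H_j) = 0 for large m iff G is a polynomial in t ([flow_polynomial],
    [flow_vanishing]).

    Given the Jacobian conjecture, it applies to the map (z - tH, t) in n + 1
    variables, whose inverse is (G, t), so G is a polynomial.

    Conversely, the vanishing property inverts z - H as soon as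
    det(1 - t dH/dz) = 1: it is applied to (T^2 H, 0) with one more variable T,
    which makes the order at least 2, and T is set to 1 in the inverse.  An
    arbitrary F of Jacobian 1, normalized to F(0) = 0 and dF/dz(0) = 1, is the
    value at t = 1 of the family F(tz)/t = z + t F_2 + t^2 F_3 + ..., also of
    Jacobian 1.  Its top coefficient in t can be moved to new variables y, by
    (z, y) -> (F_low - t^k y, y + t F_top): adding t^k times the second
    component to the first gives back F_low + t^(k+1) F_top, so the Jacobian
    is still 1 while the degree in t has dropped by one.  Iterating leaves a
    family of degree one, z - tH ([degree_reduction]). *)

Set Implicit Arguments.
Unset Strict Implicit.
Unset Printing Implicit Defensive.

Import GRing.Theory.
Local Open Scope ring_scope.

(** * Substitutions and derivations *)

Lemma mpoly_gen_ind (n : nat) (K : comNzRingType) (P : {mpoly K[n]} -> Prop) :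
  (forall c, P c%:MP) -> (forall i, P 'X_i) ->
  (forall p q, P p -> P q -> P (p + q)) ->
  (forall p q, P p -> P q -> P (p * q)) -> forall p, P p.
Proof.
move=> PC PX PD PM; elim/mpolyind => [|c m p _ _ Pp]; first by rewrite -mpolyC0.
apply: PD Pp; rewrite -mul_mpolyC; apply: (PM _ _ (PC c)).
rewrite mpolyXE_id; elim/big_rec: _ => [|i q _ Pq]; first by rewrite -mpolyC1.
apply: (PM _ _ _ Pq); elim: (m i) => [|k IH]; first by rewrite expr0 -mpolyC1.
by rewrite exprS; exact: (PM _ _ (PX i) IH).
Qed.

Section Substitution.
Context (n : nat) (K : fieldType).

Lemma mmapXU (S : comNzRingType) (f : {rmorphism K -> S}) (g : 'I_n -> S) i :
  mmap f g 'X_i = g i.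
Proof. by rewrite mmapX mmap1U. Qed.

Lemma eq_mmap (S : comNzRingType) (f f' : K -> S) (g g' : 'I_n -> S) :
  f =1 f' -> g =1 g' -> mmap f g =1 mmap f' g'.
Proof.
move=> eqf eqg p; rewrite /mmap; apply: eq_bigr => m _.
by rewrite eqf /mmap1; congr (_ * _); apply: eq_bigr => i _; rewrite eqg.
Qed.

Lemma rmorph_mmap (S S' : comNzRingType) (f : {rmorphism K -> S})
    (phi : {rmorphism S -> S'}) (g : 'I_n -> S) p :
  phi (mmap f g p) = mmap (phi \o f) (phi \o g) p.
Proof.
elim/mpoly_gen_ind: p => [c|i|p q IHp IHq|p q IHp IHq].
- by rewrite !mmapC.
- by rewrite !mmapXU.
- by rewrite !rmorphD IHp IHq.
- by rewrite !rmorphM IHp IHq.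
Qed.

Lemma mmap_id (p : {mpoly K[n]}) : mmap (@mpolyC n K) (fun i => 'X_i) p = p.
Proof.
elim/mpoly_gen_ind: p => [c|i|p q IHp IHq|p q IHp IHq].
- by rewrite mmapC.
- by rewrite mmapXU.
- by rewrite rmorphD /= IHp IHq.
- by rewrite rmorphM /= IHp IHq.
Qed.
End Substitution.

Section Derivations.
Context (S : comNzRingType) (D : {additive S -> S}).
Hypothesis DM : forall p q, D (p * q) = D p * q + p * D q.

Lemma derivation1 : D 1 = 0.
Proof.
have := DM 1 1; rewrite !mul1r mulr1 => /esym/eqP.
by rewrite -subr_eq0 addrK => /eqP.
Qed.

(** The chain rule: substituting g for the variables turns partial derivatives
    into D along g, whatever derivation D kills the constants. *)
Lemma derivation_mmap (n : nat) (K : fieldType) (f : {rmorphism K -> S})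
    (g : 'I_n -> S) u :
  (forall c, D (f c) = 0) ->
  D (mmap f g u) = \sum_k mmap f g (mderiv k u) * D (g k).
Proof.
move=> Df; elim/mpoly_gen_ind: u => [c|i|p q IHp IHq|p q IHp IHq].
- by rewrite mmapC Df big1 // => k _; rewrite mderivC rmorph0 mul0r.
- rewrite mmapXU (bigD1 i) //= big1 => [|k nki].
    rewrite mderivX mnm1E eqxx scale1r addr0.
    have ->: (U_(i) - U_(i))%MM = 0%MM :> 'X_{1..n}.
      by apply/mnmP => j; rewrite mnmBE subnn mnm0E.
    by rewrite mpolyX0 rmorph1 mul1r.
  by rewrite mderivX mnm1E eq_sym (negbTE nki) scale0r rmorph0 mul0r.
- rewrite rmorphD raddfD IHp IHq -big_split; apply: eq_bigr => k _ /=.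
  by rewrite mderivD rmorphD mulrDl.
- rewrite rmorphM DM IHp IHq mulr_suml mulr_sumr -big_split; apply: eq_bigr => k _ /=.
  by rewrite mderivM rmorphD !rmorphM mulrDl -!mulrA [D _ * _]mulrC.
Qed.

Lemma derivation_prod (I : eqType) (r : seq I) (F : I -> S) : uniq r ->
  D (\prod_(i <- r) F i) =
  \sum_(i <- r) D (F i) * \prod_(j <- r | j != i) F j.
Proof.
elim: r => [|i r IH] /=; first by rewrite !big_nil derivation1.
case/andP => nir ur; rewrite !big_cons DM IH // eqxx /=; congr (_ * _ + _).
  rewrite [LHS]big_seq [RHS]big_seq_cond; apply: eq_bigl => j.
  by case jr: (j \in r) => //=; apply/esym; apply: contraNneq nir => <-.
rewrite mulr_sumr [LHS]big_seq [RHS]big_seq; apply: eq_bigr => j jr.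
rewrite big_cons; have -> : i != j by apply: contraNneq nir => ->.
by rewrite mulrCA.
Qed.

(** Replacing one row of A by its image under D and expanding along that row
    gives the row's contribution to D (det A). *)
Lemma derivation_det m (A : 'M[S]_m) :
  D (\det A) = \sum_i \sum_j D (A i j) * cofactor A i j.
Proof.
have -> : D (\det A) =
    \sum_i \det (\matrix_(k, j) if k == i then D (A k j) else A k j).
  rewrite /determinant raddf_sum exchange_big; apply: eq_bigr => s _ /=.
  rewrite -mulr_sumr.
  have Dsg (b : bool) x : D ((-1) ^+ b * x) = (-1) ^+ b * D x.
    by rewrite !mulr_sign; case: b; rewrite ?raddfN.
  rewrite Dsg; congr (_ * _).
  rewrite derivation_prod ?index_enum_uniq //; apply: eq_bigr => i _.
  rewrite [RHS](bigD1 i) //= mxE eqxx; congr (_ * _).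
  by apply: eq_bigr => j /negbTE nji; rewrite mxE nji.
apply: eq_bigr => i _; rewrite (expand_det_row _ i); apply: eq_bigr => j _.
rewrite mxE eqxx; congr (_ * _); rewrite /cofactor; congr (_ * \det _).
by apply/matrixP => k l; rewrite !mxE eq_sym (negbTE (neq_lift _ _)).
Qed.
End Derivations.

Lemma sum_mul_exchange (S : comNzRingType) (n : nat) (x : S) (a V : 'I_n -> S)
    (d : 'I_n -> 'I_n -> S) :
  \sum_k a k * (x * \sum_j d j k * V j) = x * \sum_j V j * \sum_k a k * d j k.
Proof.
under [in RHS]eq_bigr do rewrite mulr_sumr.
rewrite exchange_big [RHS]mulr_sumr; apply: eq_bigr => k _ /=.
rewrite mulrCA [in LHS]mulr_sumr; congr (_ * _); apply: eq_bigr => j _.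
by rewrite [LHS]mulrA [LHS]mulrC.
Qed.

Section Liouville.
Context (S : comNzRingType) (n : nat) (D : 'I_n -> {additive S -> S}).
Hypothesis DM : forall i p q, D i (p * q) = D i p * q + p * D i q.

(** If the matrix A evolves by A' = x (V . grad A + A (grad V)), the first term
    transports det A and the second multiplies it by div V; together they
    form the divergence of V det A. *)
Lemma liouville (x : S) (A : 'M[S]_n) (V : 'I_n -> S) :
  \sum_i \sum_j (x * \sum_k (V k * D k (A i j) + A i k * D j (V k)))
     * cofactor A i j = x * \sum_k D k (V k * \det A).
Proof.
under eq_bigr do under eq_bigr do rewrite -mulrA.
under eq_bigr do rewrite -mulr_sumr.
rewrite -mulr_sumr; congr (_ * _).
under eq_bigr do under eq_bigr do rewrite mulr_suml.
under eq_bigr do rewrite exchange_big /=.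
rewrite exchange_big; apply: eq_bigr => k _ /=.
rewrite DM (derivation_det (DM k)) addrC.
under eq_bigr do under eq_bigr do rewrite mulrDl.
under eq_bigr do rewrite big_split /=.
rewrite big_split /=; congr (_ + _).
  rewrite mulr_sumr; apply: eq_bigr => i _; rewrite mulr_sumr.
  by apply: eq_bigr => j _; rewrite mulrA.
rewrite exchange_big /=.
have hadj j : \sum_i A i k * cofactor A i j = (\det A) *+ (j == k).
  have := congr1 (fun B : 'M_n => B j k) (mul_adj_mx A).
  rewrite /= !mxE => <-; apply: eq_bigr => i _; rewrite !mxE mulrC //.
transitivity (\sum_j D j (V k) * (\det A *+ (j == k))).
  apply: eq_bigr => j _; rewrite -hadj mulr_sumr; apply: eq_bigr => i _.
  by rewrite mulrA [D j _ * _]mulrC.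
rewrite (bigD1 k) //= eqxx big1 ?addr0 // => j /negbTE ->.
by rewrite mulr0n mulr0.
Qed.

Lemma divergence_product (x e d : S) (V : 'I_n -> S) :
  x * (\sum_j V j * D j e) * d + e * (x * \sum_k D k (V k * d)) =
  x * \sum_j D j (e * V j * d).
Proof.
rewrite -mulrA [e * _]mulrCA -mulrDr; congr (_ * _).
rewrite mulr_suml mulr_sumr -big_split; apply: eq_bigr => j _ /=.
by rewrite -(mulrA e) (DM _ e); congr (_ + _); rewrite mulrCA mulrA mulrC mulrA.
Qed.
End Liouville.

(** * The transport equation modulo powers of t *)

Section Congruence.
Context (M : comNzRingType).
Implicit Types (p q : {poly M}) (N : nat).

Definition cong N p q := forall i, (i < N)%N -> p`_i = q`_i.

Lemma cong_refl N p : cong N p p. Proof. by []. Qed.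
Arguments cong_refl : clear implicits.

Lemma cong_sym N p q : cong N p q -> cong N q p.
Proof. by move=> h i iN; rewrite h. Qed.

Lemma cong_trans N q p r : cong N p q -> cong N q r -> cong N p r.
Proof. by move=> h1 h2 i iN; rewrite h1 ?h2. Qed.

Lemma congW N k p q : (k <= N)%N -> cong N p q -> cong k p q.
Proof. by move=> kN h i ik; apply: h; apply: leq_trans kN. Qed.

Lemma congD N p p' q q' : cong N p p' -> cong N q q' -> cong N (p + q) (p' + q').
Proof. by move=> h1 h2 i iN; rewrite !coefD h1 ?h2. Qed.

Lemma congN N p p' : cong N p p' -> cong N (- p) (- p').
Proof. by move=> h1 i iN; rewrite !coefN h1. Qed.

Lemma congB N p p' q q' : cong N p p' -> cong N q q' -> cong N (p - q) (p' - q').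
Proof. by move=> h1 h2; apply: congD => //; apply: congN. Qed.

Lemma congM N p p' q q' : cong N p p' -> cong N q q' -> cong N (p * q) (p' * q').
Proof.
move=> h1 h2 i iN; rewrite !coefM; apply: eq_bigr => j _.
rewrite h1 ?h2 //; first by apply: leq_ltn_trans iN; rewrite leq_subr.
by apply: leq_ltn_trans iN; rewrite -ltnS.
Qed.

Lemma cong_sum N (I : Type) (r : seq I) (P : pred I) (F F' : I -> {poly M}) :
  (forall i, cong N (F i) (F' i)) ->
  cong N (\sum_(i <- r | P i) F i) (\sum_(i <- r | P i) F' i).
Proof. by move=> h; apply: big_ind2 => // *; apply: congD. Qed.

Lemma cong_prod N (I : Type) (r : seq I) (P : pred I) (F F' : I -> {poly M}) :
  (forall i, cong N (F i) (F' i)) ->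
  cong N (\prod_(i <- r | P i) F i) (\prod_(i <- r | P i) F' i).
Proof. by move=> h; apply: big_ind2 => // *; apply: congM. Qed.

Lemma cong_exp N p p' k : cong N p p' -> cong N (p ^+ k) (p' ^+ k).
Proof.
by move=> h; elim: k => [|k IH]; rewrite ?expr0 // !exprS; apply: congM.
Qed.

Lemma cong_det N m (A B : 'M[{poly M}]_m) :
  (forall i j, cong N (A i j) (B i j)) -> cong N (\det A) (\det B).
Proof.
by move=> h; apply: cong_sum => s; apply: congM => //; apply: cong_prod.
Qed.

Lemma cong_mmap N n (K : fieldType) (f : K -> {poly M}) (g g' : 'I_n -> {poly M}) u :
  (forall i, cong N (g i) (g' i)) -> cong N (mmap f g u) (mmap f g' u).
Proof.
move=> h; apply: cong_sum => m; apply: congM => //.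
by apply: cong_prod => i; apply: cong_exp.
Qed.

Lemma congXM N p q : cong N p q -> cong N.+1 ('X * p) ('X * q).
Proof. by move=> h [|i] iN; rewrite ![_ * p]mulrC ![_ * q]mulrC !coefMX //= h. Qed.

Lemma cong_eq p q : (forall N, cong N p q) -> p = q.
Proof. by move=> h; apply/polyP => i; apply: (h i.+1). Qed.

Lemma congP N p q : cong N p q -> exists r, p = q + r * 'X^N.
Proof.
move=> h; exists (drop_poly N (p - q)).
have {1}-> : p = q + (p - q) by rewrite addrC subrK.
congr (_ + _); rewrite -[LHS](poly_take_drop N) -[RHS]add0r; congr (_ + _).
by apply/polyP => i; rewrite coef_take_poly coef0; case: ltnP => // /h;
   rewrite coefB => ->; rewrite subrr.
Qed.

Lemma congMXn N p r : cong N (p + r * 'X^N) p.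
Proof. by move=> i iN; rewrite coefD coefMXn iN addr0. Qed.

(** A map that gains one power of t has at most one fixed point modulo t^N. *)
Lemma cong_contract (I : Type) (Phi : (I -> {poly M}) -> I -> {poly M}) N a b :
  (forall k c d, (forall i, cong k (c i) (d i)) ->
     forall i, cong k.+1 (Phi c i) (Phi d i)) ->
  (forall i, cong N (a i) (Phi a i)) -> (forall i, cong N (b i) (Phi b i)) ->
  forall i, cong N (a i) (b i).
Proof.
move=> hP ha hb; suff: forall k, (k <= N)%N -> forall i, cong k (a i) (b i).
  by move=> h; apply: h.
elim=> [//|k IH] kN i; apply: cong_trans (congW kN (ha i)) _.
apply: cong_trans (cong_sym (congW kN (hb i))).
by apply: hP; apply: IH; apply: ltnW.
Qed.
End Congruence.

Section Flow.
Context (n : nat) (K : fieldType).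
Local Notation M := {mpoly K[n]}.
Local Notation R := {poly {mpoly K[n]}}.
Implicit Types (p q : R).

Definition zsubst {m} (G : 'I_m -> R) (u : {mpoly K[m]}) : R :=
  mmap (polyC \o @mpolyC n K) G u.

HB.instance Definition _ m (G : 'I_m -> R) :=
  GRing.RMorphism.copy (zsubst G) (mmap (polyC \o @mpolyC n K) G).

Definition dz (i : 'I_n) : R -> R := map_poly (mderiv i).
(** The Euler operator t d/dt rather than d/dt: it preserves congruences modulo
    t^N with no loss of order. *)
Definition dt (p : R) : R := 'X * p^`().

Lemma dz_additive i : additive (dz i).
Proof. by move=> p q; rewrite /dz raddfB. Qed.
HB.instance Definition _ i := GRing.isAdditive.Build R R (dz i) (dz_additive i).

Lemma dt_additive : additive dt.
Proof. by move=> p q; rewrite /dt derivB mulrBr. Qed.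
HB.instance Definition _ := GRing.isAdditive.Build R R dt dt_additive.

Lemma coef_dz i p k : (dz i p)`_k = mderiv i p`_k.
Proof. by rewrite coef_map. Qed.

Lemma coef_dt p k : (dt p)`_k = p`_k *+ k.
Proof. by rewrite /dt mulrC coefMX; case: k => [|k] //=; rewrite coef_deriv. Qed.

Lemma dzM i p q : dz i (p * q) = dz i p * q + p * dz i q.
Proof.
apply/polyP => k; rewrite coefD coef_dz !coefM raddf_sum -big_split.
by apply: eq_bigr => j _; rewrite /= !coef_dz mderivM.
Qed.

Lemma dtM p q : dt (p * q) = dt p * q + p * dt q.
Proof. by rewrite /dt derivM mulrDr mulrA mulrCA. Qed.

Lemma dzC i u : dz i u%:P = (mderiv i u)%:P.
Proof. by rewrite /dz map_polyC. Qed.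

Lemma dzX i : dz i 'X = 0.
Proof.
by apply/polyP => k; rewrite coef_dz coefX coef0 -mpolyC_nat mderivC.
Qed.

Lemma dzXn i m : dz i 'X^m = 0.
Proof.
by apply/polyP => k; rewrite coef_dz coefXn coef0 -mpolyC_nat mderivC.
Qed.

Lemma dtC u : dt u%:P = 0.
Proof. by rewrite /dt derivC mulr0. Qed.

Lemma dtX : dt 'X = 'X.
Proof. by rewrite /dt derivX mulr1. Qed.

Lemma dz_comm i j p : dz i (dz j p) = dz j (dz i p).
Proof. by apply/polyP => k; rewrite !coef_dz mderiv_comm. Qed.

Lemma dtz_comm i p : dt (dz i p) = dz i (dt p).
Proof. by apply/polyP => k; rewrite coef_dt !coef_dz coef_dt mderivMn. Qed.

Lemma cong_dz N i p q : cong N p q -> cong N (dz i p) (dz i q).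
Proof. by move=> h k kN; rewrite !coef_dz h. Qed.

Lemma cong_dt N p q : cong N p q -> cong N (dt p) (dt q).
Proof. by move=> h k kN; rewrite !coef_dt h. Qed.

Lemma dz_zsubst m i (G : 'I_m -> R) u :
  dz i (zsubst G u) = \sum_k zsubst G (mderiv k u) * dz i (G k).
Proof.
apply: (derivation_mmap (dzM i) (f := polyC \o @mpolyC n K)) => c /=.
by rewrite dzC mderivC.
Qed.

Lemma dt_zsubst m (G : 'I_m -> R) u :
  dt (zsubst G u) = \sum_k zsubst G (mderiv k u) * dt (G k).
Proof.
by apply: (derivation_mmap dtM (f := polyC \o @mpolyC n K)) => c /=; rewrite dtC.
Qed.

Lemma zsubst_id u : zsubst (fun i => ('X_i : M)%:P) u = u%:P.
Proof.
by rewrite -[in RHS](mmap_id u) rmorph_mmap.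
Qed.

Lemma mderivXU i j : mderiv i ('X_j : M) = (j == i)%:R.
Proof.
rewrite mderivX mnm1E; have [<-|_] := eqVneq j i; last by rewrite scale0r.
have ->: (U_(j) - U_(j))%MM = 0%MM :> 'X_{1..n}.
  by apply/mnmP => k; rewrite mnmBE subnn mnm0E.
by rewrite scale1r mpolyX0.
Qed.

Section Equation.
Context (H : 'I_n -> M) (N : nat).

(** G is modulo t^N the inverse of z - tH. *)
Definition flow_approx (G : 'I_n -> R) :=
  forall i, cong N (G i) (('X_i : M)%:P + 'X * zsubst G (H i)).

Context (G : 'I_n -> R) (flowG : flow_approx G).
Let V i : R := zsubst G (H i).

Definition jac_z : 'M[R]_n := \matrix_(i, j) dz j (G i).
(** The density u carried by the map G, as in a change of variables. *)
Definition transport u : R := zsubst G u * \det jac_z.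

Lemma flow_dz i j : cong N (dz j (G i)) ((i == j)%:R
    + 'X * \sum_k zsubst G (mderiv k (H i)) * dz j (G k)).
Proof.
apply: cong_trans (cong_dz j (flowG i)) _.
rewrite raddfD /= dzM dzX mul0r add0r dz_zsubst dzC mderivXU rmorph_nat.
exact: cong_refl.
Qed.

(** The velocity of the flow.  Both sides solve the same linear equation
    a = t (V + H'(G) a), obtained by differentiating G = z + t H(G) in t on the
    one hand and in z on the other, and that equation is contracting. *)
Lemma flow_dt i : cong N (dt (G i)) ('X * \sum_j dz j (G i) * V j).
Proof.
pose Phi (a : 'I_n -> R) i := 'X * (V i + \sum_k zsubst G (mderiv k (H i)) * a k).
move: i; apply: (cong_contract (Phi := Phi)) => [k c d hcd i|i|i].
- apply: congXM; apply: congD => //; apply: cong_sum => j.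
  exact: congM.
- apply: cong_trans (cong_dt (flowG i)) _.
  by rewrite raddfD /= dtC add0r dtM dtX dt_zsubst /Phi mulrDr; apply: cong_refl.
have hdz j := flow_dz i j.
rewrite /Phi; apply: (@congM _ _ 'X 'X) => //.
apply: (cong_trans (q := \sum_j ((i == j)%:R
    + 'X * \sum_k zsubst G (mderiv k (H i)) * dz j (G k)) * V j)).
  by apply: cong_sum => j; apply: congM.
under eq_bigr => j _ do rewrite mulrDl.
rewrite big_split /= (bigD1 i) //= eqxx mul1r big1 ?addr0 => [|j]; last first.
  by rewrite eq_sym => /negbTE ->; rewrite mul0r.
apply: congD => //.
rewrite (sum_mul_exchange 'X (fun k => zsubst G (mderiv k (H i))) V (fun j k => dz j (G k))).
have -> : \sum_j 'X * (\sum_k zsubst G (mderiv k (H i)) * dz j (G k)) * V j =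
    'X * \sum_j V j * \sum_k zsubst G (mderiv k (H i)) * dz j (G k).
  by rewrite mulr_sumr; apply: eq_bigr => j _; rewrite -mulrA; congr (_ * _); apply: mulrC.
exact: cong_refl.
Qed.

Lemma dt_zsubst_flow u :
  cong N (dt (zsubst G u)) ('X * \sum_j V j * dz j (zsubst G u)).
Proof.
rewrite dt_zsubst.
apply: (cong_trans (q :=
  \sum_k zsubst G (mderiv k u) * ('X * \sum_j dz j (G k) * V j))).
  by apply: cong_sum => k; apply: congM => //; exact: flow_dt.
rewrite (sum_mul_exchange 'X (fun k => zsubst G (mderiv k u)) V (fun j k => dz j (G k))).
have -> // : \sum_j V j * (\sum_k zsubst G (mderiv k u) * dz j (G k)) =
  \sum_j V j * dz j (zsubst G u).
by apply: eq_bigr => j _; rewrite dz_zsubst.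
Qed.

Lemma dt_det_flow : cong N (dt (\det jac_z)) ('X * \sum_k dz k (V k * \det jac_z)).
Proof.
rewrite (derivation_det dtM).
have h i j : cong N (dt (jac_z i j))
    ('X * \sum_k (V k * dz k (jac_z i j) + jac_z i k * dz j (V k))).
  rewrite !mxE dtz_comm; apply: cong_trans (cong_dz j (flow_dt i)) _.
  rewrite dzM dzX mul0r add0r raddf_sum /=.
  apply: congM => //; apply: cong_sum => k; rewrite dzM dz_comm !mxE [V k * _]mulrC.
  exact: cong_refl.
apply: (cong_trans (q := \sum_i \sum_j ('X * \sum_k (V k * dz k (jac_z i j)
    + jac_z i k * dz j (V k))) * cofactor jac_z i j)).
  by do 2!apply: cong_sum => ?; apply: congM.
rewrite (@liouville _ _ (fun i => dz i : {additive _ -> _}) dzM); exact: cong_refl.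
Qed.

(** The conservation law of a density carried by the flow of velocity H(G). *)
Lemma transport_eq u :
  cong N (dt (transport u)) ('X * \sum_j dz j (transport (u * H j))).
Proof.
rewrite /transport dtM.
apply: (cong_trans (q := 'X * (\sum_j V j * dz j (zsubst G u)) * \det jac_z
    + zsubst G u * ('X * \sum_k dz k (V k * \det jac_z)))).
  by apply: congD; apply: congM => //; [exact: dt_zsubst_flow | exact: dt_det_flow].
rewrite (@divergence_product _ _ (fun i => dz i : {additive _ -> _}) dzM).
have -> // : \sum_j dz j (zsubst G u * V j * \det jac_z) =
  \sum_j dz j (zsubst G (u * H j) * \det jac_z).
by apply: eq_bigr => j _; rewrite /zsubst rmorphM.
Qed.

End Equation.

Fixpoint iterdiv (H : 'I_n -> M) (m : nat) (u : M) : M :=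
  if m is m'.+1 then \sum_i mderiv i (iterdiv H m' (u * H i)) else u.

(** The Abhyankar-Gurjar formula: the conservation law is a recursion for the
    coefficients of [transport G u] in t, the same as that of [iterdiv]. *)
Lemma coef_transport H N G (flowG : flow_approx H N G) m u :
  (m < N)%N -> (transport G u)`_m *+ m`! = iterdiv H m u.
Proof.
elim: m u => [|m IH] u mN.
  rewrite fact0 mulr1n /=.
  have hG i : cong 1 (G i) ('X_i : M)%:P.
    apply: cong_trans (congW mN (flowG i)) _ => -[|//] _.
    by rewrite coefD mulrC coefMX addr0.
  have h : cong 1 (transport G u) (u%:P * \det (1%:M : 'M[R]_n)).
    apply: congM.
      by rewrite -zsubst_id; apply: cong_mmap.
    apply: cong_det => i j; rewrite !mxE; apply: cong_trans (cong_dz j (hG i)) _.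
    by rewrite dzC mderivXU rmorph_nat; apply: cong_refl.
  by rewrite h // det1 mulr1 coefC.
rewrite factS mulrnA -coef_dt (transport_eq flowG) // mulrC coefMX /=.
rewrite coef_sum -sumrMnl; apply: eq_bigr => i _.
by rewrite coef_dz -mderivMn IH // ltnW.
Qed.
End Flow.

(** * Powers of Lambda as iterated divergences *)

Lemma mderivX_exp (n : nat) (K : fieldType) i (p : {mpoly K[n]}) m :
  mderiv i (p ^+ m.+1) = (p ^+ m * mderiv i p) *+ m.+1.
Proof.
elim: m => [|m IH]; first by rewrite expr1 expr0 mul1r.
rewrite exprS mderivM IH [in RHS]mulrS [p ^+ m.+1 * _]mulrC; congr (_ + _).
by rewrite mulrnAr mulrA -exprS mulrC.
Qed.

Section LambdaPowers.
Context (n : nat) (K : fieldType) (H : n.-tuple {mpoly K[n]}).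
Local Notation M := {mpoly K[n]}.
Local Notation MM := {mpoly K[n + n]}.
Local Notation P := (xi_pairing H).
Local Notation h := (tnth H).

Definition zin (u : M) : MM := u \mPo zvars.
HB.instance Definition _ := GRing.RMorphism.copy zin (comp_mpoly (@zvars K n)).

Lemma mderiv_xi_zin i u : mderiv (lshift n i) (zin u) = 0.
Proof.
rewrite (derivation_mmap (mderivM _)) => [|c]; last exact: mderivC.
rewrite big1 // => k _ /=; rewrite tnth_mktuple mderivXU eq_sym eq_lrshift mulr0 //.
Qed.

Lemma mderiv_z_zin i u : mderiv (rshift n i) (zin u) = zin (mderiv i u).
Proof.
rewrite (derivation_mmap (mderivM _)) => [|c]; last exact: mderivC.
rewrite (bigD1 i) //= tnth_mktuple mderivXU eqxx mulr1 big1 ?addr0 // => k nki.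
by rewrite tnth_mktuple mderivXU (inj_eq (@rshift_inj _ _)) (negbTE nki) mulr0.
Qed.

Lemma mderiv_xi_pairing i (v : 'I_n -> M) :
  mderiv (lshift n i) (\sum_j xi j * zin (v j)) = zin (v i).
Proof.
rewrite raddf_sum (bigD1 i) //= mderivM mderiv_xi_zin mulr0 addr0 mderivXU eqxx.
rewrite mul1r big1 ?addr0 // => j nji.
rewrite mderivM mderiv_xi_zin mulr0 addr0 mderivXU (inj_eq (@lshift_inj _ _)).
by rewrite (negbTE nji) mul0r.
Qed.

Lemma zin_eq0 u : zin u = 0 -> u = 0.
Proof.
move=> /(congr1 (mmap (@mpolyC n K)
   (fun k : 'I_(n + n) => if split k is inr j then 'X_j else 0))).
rewrite rmorph0 /zin /comp_mpoly rmorph_mmap => <-.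
rewrite -[LHS]mmap_id; apply: eq_mmap => [c|i] /=; first by rewrite mmapC.
by rewrite tnth_mktuple mmapXU -[rshift n i]/(unsplit (inr i)) unsplitK.
Qed.

Lemma Lambda_additive : additive (@Lambda K n).
Proof.
by move=> p q; rewrite /Lambda -sumrB; apply: eq_bigr => i _; rewrite !raddfB.
Qed.
HB.instance Definition _ := GRing.isAdditive.Build MM MM (@Lambda K n) Lambda_additive.

Lemma Lambda_mderiv (i : 'I_(n + n)) (p : MM) :
  @Lambda K n (mderiv i p) = mderiv i (@Lambda K n p).
Proof.
rewrite /Lambda raddf_sum; apply: eq_bigr => j _ /=.
by rewrite (mderiv_comm i) (mderiv_comm i).
Qed.

(** The xi-derivative of P^(m+1) brings down the factor (m+1) H_i, so Lambda
    acts on these products as the divergence in z. *)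
Lemma Lambda_pairing_power m u :
  @Lambda K n (P ^+ m.+1 * zin u) =
  \sum_i mderiv (rshift n i) (P ^+ m * zin (u * h i)) *+ m.+1.
Proof.
apply: eq_bigr => i _; rewrite mderiv_comm mderivM mderiv_xi_zin mulr0 addr0.
rewrite mderivX_exp /xi_pairing (mderiv_xi_pairing i h) -mderivMn.
by rewrite mulrnAl -mulrA -rmorphM [h i * u]mulrC.
Qed.

Lemma iter_Lambda_sum m (F : 'I_n -> MM) k :
  iter m (@Lambda K n) (\sum_i mderiv (rshift n i) (F i) *+ k) =
  (\sum_i mderiv (rshift n i) (iter m (@Lambda K n) (F i))) *+ k.
Proof.
elim: m => [|m IH]; first by rewrite -sumrMnl.
rewrite iterS IH raddfMn raddf_sum; congr (_ *+ k).
by apply: eq_bigr => i _; rewrite /= Lambda_mderiv.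
Qed.

Lemma iter_Lambda_pairing m u :
  iter m (@Lambda K n) (P ^+ m * zin u) = zin (iterdiv h m u) *+ m`!.
Proof.
elim: m u => [|m IH] u; first by rewrite expr0 mul1r.
rewrite iterSr Lambda_pairing_power iter_Lambda_sum factS mulnC mulrnA.
congr (_ *+ _); rewrite /= raddf_sum -sumrMnl; apply: eq_bigr => i _ /=.
by rewrite IH mderivMn mderiv_z_zin.
Qed.

Lemma iter_Lambda_pairingS m u :
  iter m (@Lambda K n) (P ^+ m.+1 * zin u) =
  (\sum_j xi j * zin (iterdiv h m (u * h j))) *+ (m.+1)`!.
Proof.
elim: m u => [|m IH] u.
  rewrite expr1 mulr_suml; apply: eq_bigr => j _ /=.
  by rewrite -mulrA -/(zin _) -rmorphM [h j * u]mulrC.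
rewrite iterSr Lambda_pairing_power iter_Lambda_sum factS mulnC mulrnA.
congr (_ *+ _).
under eq_bigr do rewrite IH mderivMn raddf_sum.
rewrite sumrMnl; congr (_ *+ _); rewrite exchange_big; apply: eq_bigr => j _ /=.
rewrite raddf_sum mulr_sumr; apply: eq_bigr => i _ /=.
rewrite mderivM mderivXU eq_lrshift mul0r add0r mderiv_z_zin.
by rewrite -!mulrA [h i * _]mulrC.
Qed.

Hypothesis charK : [pchar K] =i pred0.

Lemma mpoly_natmul_eq0 k (p : {mpoly K[k]}) m : (0 < m)%N -> p *+ m = 0 -> p = 0.
Proof.
move=> m0 h0; apply/mpolyP => a; have /eqP := congr1 (mcoeff a) h0.
rewrite mcoeffMn mcoeff0 -mulr_natr mulf_eq0 => /orP[/eqP //|].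
by move/pcharf0P: charK => ->; rewrite eqn0Ngt m0.
Qed.

Lemma Lambda_power_eq0 m :
  (iter m (@Lambda K n) (P ^+ m) = 0) <-> iterdiv h m 1 = 0.
Proof.
rewrite -[P ^+ m]mulr1 -[1 in X in X <-> _](rmorph1 zin) iter_Lambda_pairing.
by split=> [/(mpoly_natmul_eq0 (fact_gt0 m))/zin_eq0 //|->]; rewrite rmorph0 mul0rn.
Qed.

(** The xi_j are independent of each other and of z, so the sum over j vanishes
    only termwise. *)
Lemma Lambda_powerS_eq0 m :
  (iter m (@Lambda K n) (P ^+ m.+1) = 0) <-> forall j, iterdiv h m (h j) = 0.
Proof.
rewrite -[P ^+ m.+1]mulr1 -[1 in X in X <-> _](rmorph1 zin) iter_Lambda_pairingS.
under eq_bigr do rewrite mul1r.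
split=> [/(mpoly_natmul_eq0 (fact_gt0 _)) h0 j|h0].
  by apply: zin_eq0; rewrite -(mderiv_xi_pairing j (fun j => iterdiv h m (h j))) h0 mderiv0.
by rewrite big1 ?mul0rn // => j _; rewrite h0 rmorph0 mulr0.
Qed.
End LambdaPowers.

(** * The pencil z - tH and its inverse *)

Section SubstitutionZT.
Context (n : nat) (K : fieldType).
Local Notation M := {mpoly K[n]}.
Local Notation R := {poly {mpoly K[n]}}.

(** Substitution of g for z and s for t, into an arbitrary K-algebra A. *)
Definition ztsubst (A : comNzRingType) (f : {rmorphism K -> A}) (g : 'I_n -> A)
    (s : A) : R -> A := horner_eval s \o map_poly (mmap f g).
HB.instance Definition _ (A : comNzRingType) (f : {rmorphism K -> A}) g s :=
  GRing.RMorphism.copy (ztsubst f g s) (horner_eval s \o map_poly (mmap f g)).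

Section IntoAnyAlgebra.
Context (A : comNzRingType) (f : {rmorphism K -> A}) (g : 'I_n -> A) (s : A).

Lemma ztsubstC u : ztsubst f g s u%:P = mmap f g u.
Proof. by rewrite /ztsubst /= map_polyC /= /horner_eval hornerC. Qed.

Lemma ztsubstX : ztsubst f g s 'X = s.
Proof. by rewrite /ztsubst /= map_polyX /horner_eval hornerX. Qed.

Lemma rmorph_ztsubst (B : comNzRingType) (phi : {rmorphism A -> B}) p :
  phi (ztsubst f g s p) = ztsubst (phi \o f) (phi \o g) (phi s) p.
Proof.
rewrite /ztsubst /= /horner_eval -horner_map -map_poly_comp; congr (_.[_]).
by apply: eq_map_poly => u /=; rewrite rmorph_mmap.
Qed.

Lemma ztsubst_mmap s' p : s = mmap f g s' -> ztsubst f g s p = mmap f g p.[s'].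
Proof. by move=> ->; rewrite -horner_map. Qed.

Lemma ztsubst_pencil_entry (c : nat) u :
  ztsubst f g s (c%:R - 'X * u%:P) = c%:R - s * mmap f g u.
Proof. by rewrite rmorphB rmorphM rmorph_nat /= ztsubstX ztsubstC. Qed.

End IntoAnyAlgebra.

Lemma poly_gen_ind (P : R -> Prop) :
  (forall u, P u%:P) -> P 'X -> (forall p q, P p -> P q -> P (p + q)) ->
  (forall p q, P p -> P q -> P (p * q)) -> forall p, P p.
Proof.
move=> PC PX PD PM; elim/poly_ind => [|p c Pp]; first by rewrite -polyC0.
exact: PD _ _ (PM _ _ Pp PX) (PC c).
Qed.

Lemma eq_ztsubst (A : comNzRingType) (f f' : {rmorphism K -> A}) g g' s s' p :
  f =1 f' -> g =1 g' -> s = s' -> ztsubst f g s p = ztsubst f' g' s' p.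
Proof.
move=> eqf eqg ->; rewrite /ztsubst /= /horner_eval; congr (_.[_]).
by apply: eq_map_poly => u; apply: eq_mmap.
Qed.

Definition cstR : {rmorphism K -> R} := polyC \o @mpolyC n K.

Definition tsubst (G : 'I_n -> R) : R -> R := ztsubst cstR G 'X.
HB.instance Definition _ G := GRing.RMorphism.copy (tsubst G) (ztsubst cstR G 'X).

Lemma tsubstC G u : tsubst G u%:P = zsubst G u. Proof. exact: ztsubstC. Qed.
Lemma tsubstX G : tsubst G 'X = 'X. Proof. exact: ztsubstX. Qed.

Lemma tsubst_zsubst m F (G : 'I_m -> R) u : tsubst F (zsubst G u) = zsubst (tsubst F \o G) u.
Proof.
rewrite /zsubst rmorph_mmap; apply: eq_mmap => // c /=.
by rewrite tsubstC /zsubst mmapC.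
Qed.

Lemma tsubst_comp F G p : tsubst F (tsubst G p) = tsubst (tsubst F \o G) p.
Proof.
rewrite [LHS]rmorph_ztsubst; apply: eq_ztsubst => //; last exact: tsubstX.
by move=> c /=; rewrite tsubstC /zsubst mmapC.
Qed.

Lemma tsubst_id p : tsubst (fun i => ('X_i : M)%:P) p = p.
Proof.
elim/poly_gen_ind: p => [u||p q IHp IHq|p q IHp IHq].
- by rewrite tsubstC zsubst_id.
- by rewrite tsubstX.
- by rewrite rmorphD /= IHp IHq.
- by rewrite rmorphM /= IHp IHq.
Qed.

Lemma cong_tsubst N G p q : cong N p q -> cong N (tsubst G p) (tsubst G q).
Proof.
move=> /congP[r ->]; rewrite rmorphD rmorphM rmorphXn /= tsubstX.
exact: congMXn.
Qed.

Lemma cong_tsubstl N G G' p : (forall i, cong N (G i) (G' i)) ->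
  cong N (tsubst G p) (tsubst G' p).
Proof.
move=> h; elim/poly_gen_ind: p => [u||p q IHp IHq|p q IHp IHq].
- by rewrite !tsubstC; apply: cong_mmap.
- by rewrite !tsubstX.
- by rewrite 2!rmorphD /=; exact: congD IHp IHq.
- by rewrite 2!rmorphM /=; exact: congM IHp IHq.
Qed.
End SubstitutionZT.

Section Nilpotent.
Context (n : nat) (K : fieldType) (H : 'I_n -> {mpoly K[n]}).
Local Notation M := {mpoly K[n]}.
Local Notation R := {poly {mpoly K[n]}}.

Definition pencil : 'I_n -> R := fun i => ('X_i : M)%:P - 'X * (H i)%:P.

Lemma flow_exists N : exists G, flow_approx H N G.
Proof.
elim: N => [|N [G hG]]; first by exists (fun _ => 0) => i [].
exists (fun i => ('X_i : M)%:P + 'X * zsubst G (H i)) => i.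
apply: congD => //; apply: congXM; apply: cong_mmap => j; exact: hG.
Qed.

(** Since z - tH has G as right inverse, G is also its left inverse: w = G(z - tH)
    and w = z both solve w = (z - tH) + t H(w), which is contracting. *)
Lemma tsubst_pencil_flow N G : flow_approx H N G ->
  forall i, cong N (tsubst pencil (G i)) ('X_i : M)%:P.
Proof.
move=> hG i; move: i.
pose Phi (a : 'I_n -> R) i := pencil i + 'X * zsubst a (H i).
apply: (cong_contract (Phi := Phi)) => [k c d hcd i|i|i].
- by apply: congD => //; apply: congXM; apply: cong_mmap.
- apply: cong_trans (cong_tsubst pencil (hG i)) _.
  by rewrite rmorphD rmorphM /= tsubstX tsubstC tsubst_zsubst /zsubst mmapXU; apply: cong_refl.
- by rewrite /Phi zsubst_id subrK; apply: cong_refl.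
Qed.

Lemma jac_z_pencil i j :
  jac_z pencil i j = (i == j)%:R - 'X * (mderiv j (H i))%:P.
Proof.
by rewrite mxE /pencil raddfB /= dzM dzX mul0r add0r !dzC mderivXU rmorph_nat.
Qed.

(** Differentiating z = G - t H(G) in z. *)
Lemma flow_jacobian N G : flow_approx H N G ->
  cong N (tsubst G (\det (jac_z pencil)) * \det (jac_z G)) 1.
Proof.
move=> hG; rewrite -det_map_mx -det_mulmx -(det1 R n); apply: cong_det => i j.
rewrite !mxE.
have -> : \sum_k map_mx (tsubst G) (jac_z pencil) i k * jac_z G k j =
  dz j (G i) - 'X * \sum_k zsubst G (mderiv k (H i)) * dz j (G k).
  rewrite mulr_sumr -sumrN.
  have {1}-> : dz j (G i) = \sum_k (i == k)%:R * dz j (G k).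
    rewrite (bigD1 i) //= eqxx mul1r big1 ?addr0 // => k.
    by rewrite eq_sym => /negbTE ->; rewrite mul0r.
  rewrite -big_split; apply: eq_bigr => k _ /=.
  rewrite mxE jac_z_pencil !mxE rmorphB rmorphM rmorph_nat /= tsubstX tsubstC.
  by rewrite mulrBl mulrA.
rewrite -[X in cong _ _ X](addrK ('X * \sum_k zsubst G (mderiv k (H i)) * dz j (G k))).
by apply: congB => //; apply: flow_dz.
Qed.

Lemma transport1 N G : flow_approx H N G -> cong N (transport G 1) (\det (jac_z G)).
Proof. by move=> hG; rewrite /transport rmorph1 mul1r; apply: cong_refl. Qed.

Lemma det_flow N G : \det (jac_z pencil) = 1 -> flow_approx H N G ->
  cong N (\det (jac_z G)) 1.
Proof. by move=> h1 /flow_jacobian; rewrite h1 rmorph1 mul1r. Qed.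

Lemma iterdiv1_eq0 m : \det (jac_z pencil) = 1 -> (0 < m)%N -> iterdiv H m 1 = 0.
Proof.
move=> h1 m0; have [G hG] := flow_exists m.+1.
rewrite -(coef_transport hG _ (ltnSn m)) (transport1 hG (ltnSn m)).
by rewrite (det_flow h1 hG (ltnSn m)) coef1 eqn0Ngt m0 mul0rn.
Qed.

Hypothesis charK : [pchar K] =i pred0.

(** The formula gives det(dG/dz) = 1, hence the determinant of the pencil is 1 at
    z = G; substituting z - tH for z removes G. *)
Lemma det_pencil_eq1 : (forall m, (0 < m)%N -> iterdiv H m 1 = 0) ->
  \det (jac_z pencil) = 1.
Proof.
move=> h; apply: cong_eq => N; have [G hG] := flow_exists N.
have hJ : cong N (\det (jac_z G)) 1.
  move=> m mN; rewrite -(transport1 hG mN) coef1.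
  have := coef_transport hG 1 mN; case: m mN => [|m] mN; first by rewrite fact0.
  by rewrite h // => /(mpoly_natmul_eq0 charK (fact_gt0 _)).
have hE : cong N (tsubst G (\det (jac_z pencil))) 1.
  apply: cong_trans (flow_jacobian hG); rewrite -[X in cong _ X]mulr1.
  by apply: congM => //; apply: cong_sym.
(* Substituting z - tH for z turns G into z. *)
have := cong_tsubst pencil hE; rewrite rmorph1 tsubst_comp; apply: cong_trans.
rewrite -[X in cong _ X](tsubst_id); apply: cong_tsubstl => i; apply: cong_sym.
exact: tsubst_pencil_flow hG i.
Qed.

Definition flow (g : 'I_n -> R) :=
  forall i, g i = ('X_i : M)%:P + 'X * zsubst g (H i).

(** The coefficients of H_j(G) in t are T_m(H_j) / m!, so truncating at k loses
    nothing: the resulting polynomial solves the equation modulo every t^N. *)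
Lemma flow_polynomial k : \det (jac_z pencil) = 1 ->
  (forall m, (k <= m)%N -> forall j, iterdiv H m (H j) = 0) -> exists g, flow g.
Proof.
move=> h1 hT.
pose h j : R := \poly_(m < k) (((m`!)%:R : K)^-1 *: iterdiv H m (H j)).
exists (fun i => ('X_i : M)%:P + 'X * h i) => i; apply: cong_eq => N.
have [G hG] := flow_exists N.
have hV j : cong N (zsubst G (H j)) (h j).
  move=> m mN.
  have e : cong N (transport G (H j)) (zsubst G (H j)).
    rewrite -[X in cong _ _ X]mulr1; apply: congM => //; exact: det_flow hG.
  have := coef_transport hG (H j) mN; rewrite e // coef_poly.
  have nz : (m`!%:R : K) != 0.
    by move/pcharf0P: charK => ->; rewrite -lt0n fact_gt0.
  case: ltnP => [_ <-|/hT -> /(mpoly_natmul_eq0 charK (fact_gt0 _)) //].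
  by rewrite -scaler_nat scalerA mulVf // scale1r.
have hg j : cong N (('X_j : M)%:P + 'X * h j) (G j).
  apply: cong_trans (cong_sym (hG j)); apply: congD => //; apply: congM => //.
  exact: cong_sym.
apply: cong_trans (hg i) _; apply: cong_trans (hG i) _.
apply: congD => //; apply: congM => //; apply: cong_mmap => j.
exact: cong_sym.
Qed.

Lemma flow_vanishing g : \det (jac_z pencil) = 1 -> flow g ->
  exists k, forall m, (k <= m)%N -> forall j, iterdiv H m (H j) = 0.
Proof.
move=> h1 hg; exists (\max_j size (zsubst g (H j))) => m km j.
have hG : flow_approx H m.+1 g by move=> i; rewrite {1}hg; apply: cong_refl.
rewrite -(coef_transport hG _ (ltnSn m)).
have e : cong m.+1 (transport g (H j)) (zsubst g (H j)).
  rewrite -[X in cong _ _ X]mulr1; apply: congM => //; exact: det_flow hG.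
rewrite e // nth_default ?mul0rn //; apply: leq_trans km.
exact: (leq_bigmax (F := fun j => size (zsubst g (H j)))).
Qed.

End Nilpotent.

Definition inverse_pair n (K : fieldType) (F G : 'I_n -> {mpoly K[n]}) :=
  (forall i, mmap (@mpolyC n K) G (F i) = 'X_i) /\
  (forall i, mmap (@mpolyC n K) F (G i) = 'X_i).

Lemma flow_inverse n (K : fieldType) (H : 'I_n -> {mpoly K[n]}) g : flow H g ->
  inverse_pair (fun i => 'X_i - H i) (fun i => (g i).[1]).
Proof.
move=> hg.
have zsubst1 u : horner_eval 1 (zsubst g u) = mmap (@mpolyC n K) (fun i => (g i).[1]) u.
  rewrite /zsubst rmorph_mmap; apply: eq_mmap => // c /=.
  by rewrite /horner_eval hornerC.
split=> i.
  rewrite rmorphB /= mmapXU -zsubst1 [in X in X - _]hg hornerD hornerC hornerM hornerX mul1r.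
  exact: addrK.
have : tsubst (pencil H) (g i) = ('X_i)%:P.
  apply: cong_eq => N; apply: (tsubst_pencil_flow (G := g)) => j.
  by rewrite {1}hg; apply: cong_refl.
move=> /(congr1 (horner_eval 1)); rewrite [LHS]rmorph_ztsubst.
have -> : horner_eval 1 ('X_i)%:P = 'X_i :> {mpoly K[n]}.
  by rewrite /horner_eval hornerC.
move=> <-; rewrite -(ztsubst_mmap (s := 1)) ?rmorph1 //; apply: eq_ztsubst.
- by move=> c /=; rewrite /horner_eval hornerC.
- by move=> j /=; rewrite /horner_eval /pencil !hornerE.
- by rewrite /= /horner_eval hornerX.
Qed.

(** * From the Jacobian conjecture to the flow *)

Section Automorphisms.
Context (n : nat) (K : fieldType).

Lemma polymap_automorphismP (F : n.-tuple {mpoly K[n]}) :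
  polymap_automorphism F <-> exists G, inverse_pair (tnth F) G.
Proof.
split=> [[G [hFG hGF]]|[G [hFG hGF]]].
  exists (tnth G); split=> i.
    by have := congr1 (fun t => tnth t i) hFG; rewrite !tnth_mktuple.
  by have := congr1 (fun t => tnth t i) hGF; rewrite !tnth_mktuple.
exists [tuple G i | i < n]; split; apply: eq_from_tnth => i; rewrite !tnth_mktuple.
  by rewrite -hFG; apply: eq_mmap => // j; rewrite tnth_mktuple.
by rewrite -hGF; apply: eq_mmap.
Qed.

Lemma eq_inverse_pair (F F' G : 'I_n -> {mpoly K[n]}) :
  F =1 F' -> inverse_pair F G -> inverse_pair F' G.
Proof.
move=> e [h1 h2]; split=> i; first by rewrite -e.
by rewrite -h2; apply: eq_mmap => // j; rewrite e.
Qed.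
End Automorphisms.

Section Widen.
Context (K : fieldType) (n m : nat).

Definition widenl (u : {mpoly K[n]}) : {mpoly K[n + m]} :=
  mmap (@mpolyC (n + m) K) (fun i => 'X_(lshift m i)) u.
HB.instance Definition _ := GRing.RMorphism.copy widenl
  (mmap (@mpolyC (n + m) K) (fun i => 'X_(lshift m i))).

Lemma mderiv_widenl j u : mderiv (lshift m j) (widenl u) = widenl (mderiv j u).
Proof.
rewrite (derivation_mmap (mderivM _)) => [|c]; last exact: mderivC.
rewrite (bigD1 j) //= mderivXU eqxx mulr1 big1 ?addr0 // => k nkj.
by rewrite mderivXU (inj_eq (@lshift_inj _ _)) (negbTE nkj) mulr0.
Qed.

Lemma mderivr_widenl j u : mderiv (rshift n j) (widenl u) = 0.
Proof.
rewrite (derivation_mmap (mderivM _)) => [|c]; last exact: mderivC.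
by rewrite big1 // => k _ /=; rewrite mderivXU eq_lrshift mulr0.
Qed.

Lemma mmap_widenl (A : comNzRingType) (f : {rmorphism K -> A}) g u :
  mmap f g (widenl u) = mmap f (g \o lshift m) u.
Proof.
rewrite /widenl rmorph_mmap; apply: eq_mmap => [c|i] /=; first by rewrite mmapC.
by rewrite mmapXU.
Qed.

Definition blocks {A : Type} (a : 'I_n -> A) (b : 'I_m -> A) (i : 'I_(n + m)) : A :=
  match split i with inl j => a j | inr j => b j end.

Lemma blocksl A (a : 'I_n -> A) b j : blocks a b (lshift m j) = a j.
Proof. by rewrite /blocks -[lshift m j]/(unsplit (inl j)) unsplitK. Qed.

Lemma blocksr A (a : 'I_n -> A) b j : blocks a b (rshift n j) = b j.
Proof. by rewrite /blocks -[rshift n j]/(unsplit (inr j)) unsplitK. Qed.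

Lemma blocksP A (g h : 'I_(n + m) -> A) :
  (forall j, g (lshift m j) = h (lshift m j)) ->
  (forall j, g (rshift n j) = h (rshift n j)) -> g =1 h.
Proof. by move=> hl hr i; case: (split_ordP i) => j ->. Qed.

End Widen.

Section JCImpliesVanishing.
Context (n : nat) (K : fieldType) (H : 'I_n -> {mpoly K[n]}).
Local Notation R := {poly {mpoly K[n]}}.
Local Notation MM := {mpoly K[n + 1]}.
Let T : MM := 'X_(rshift n (@ord0 0)).

(** The pencil z - tH as one polynomial map, its parameter t becoming the last
    variable T. *)
Definition homotopy : (n + 1).-tuple MM :=
  [tuple blocks (fun j => 'X_(lshift 1 j) - T * widenl 1 (H j)) (fun=> T) i | i < n + 1].

Lemma det_homotopy : \det (jac_z (pencil H)) = 1 -> \det (jacobian homotopy) = 1.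
Proof.
move=> h1; rewrite -(submxK (jacobian homotopy)).
have -> : dlsubmx (jacobian homotopy) = 0.
  by apply/matrixP => i j; rewrite !mxE tnth_mktuple blocksr mderivXU eq_rlshift.
have -> : drsubmx (jacobian homotopy) = 1%:M.
  apply/matrixP => i j; rewrite !mxE tnth_mktuple blocksr mderivXU !ord1.
  by rewrite eqxx.
rewrite det_ublock det1 mulr1.
pose psi : R -> MM := ztsubst (@mpolyC (n + 1) K) (fun i => 'X_(lshift 1 i)) T.
have -> : ulsubmx (jacobian homotopy) = map_mx psi (jac_z (pencil H)).
  apply/matrixP => i j; rewrite [RHS]mxE jac_z_pencil !mxE tnth_mktuple blocksl.
  rewrite mderivB mderivM !mderivXU eq_rlshift mul0r add0r mderiv_widenl.
  rewrite (inj_eq (@lshift_inj _ _)) /psi ztsubst_pencil_entry.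
  by [].
by rewrite det_map_mx h1 rmorph1.
Qed.

Lemma jacobian_conjecture_flow :
  (forall F : (n + 1).-tuple MM, \det (jacobian F) = 1 -> polymap_automorphism F) ->
  \det (jac_z (pencil H)) = 1 -> exists g, flow H g.
Proof.
move=> JC /det_homotopy/JC/polymap_automorphismP[G [hG _]].
pose z : 'I_(n + 1) -> R := blocks (fun i => ('X_i)%:P) (fun=> 'X).
have hT : G (rshift n ord0) = T.
  by have := hG (rshift n ord0); rewrite tnth_mktuple blocksr mmapXU.
exists (fun i => zsubst z (G (lshift 1 i))) => i.
have := hG (lshift 1 i); rewrite tnth_mktuple blocksl rmorphB rmorphM /= !mmapXU hT.
rewrite mmap_widenl => /(congr1 (zsubst z)); rewrite rmorphB rmorphM /=.
rewrite {2 4}/zsubst !mmapXU /z blocksl blocksr => <-; rewrite -/z.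
have -> : zsubst z (mmap (@mpolyC (n + 1) K) (G \o lshift 1) (H i)) =
   zsubst (fun i => zsubst z (G (lshift 1 i))) (H i).
  by rewrite {1}/zsubst rmorph_mmap; apply: eq_mmap => // c /=; rewrite mmapC.
by rewrite subrK.
Qed.
End JCImpliesVanishing.

(** * Reduction to a linear pencil of order at least two *)

Lemma leq_tuple_order (K : fieldType) n k d (H : k.-tuple {mpoly K[n]}) :
  (forall i m, m \in msupp (tnth H i) -> (d <= mdeg m)%N) ->
  leq_xnat d (tuple_order H).
Proof.
have hmin a b : leq_xnat d a -> leq_xnat d b -> leq_xnat d (xmin a b).
  by case: a b => [a|] [b|] //=; rewrite leq_min => -> ->.
move=> h; rewrite /tuple_order; elim/big_ind: _ => // i _.
by rewrite /mporder big_seq; elim/big_ind: _ => // m; apply: h.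
Qed.

Section Quadratic.
Context (n : nat) (K : fieldType) (H : 'I_n -> {mpoly K[n]}).
Local Notation R := {poly {mpoly K[n]}}.
Local Notation MM := {mpoly K[n + 1]}.
Let T : MM := 'X_(rshift n (@ord0 0)).

(** The factor T^2 raises the order of any H, constant terms included, to at
    least two. *)
Definition scaled : 'I_(n + 1) -> MM := blocks (fun j => T ^+ 2 * widenl 1 (H j)) (fun=> 0).

Lemma order_scaled : leq_xnat 2 (tuple_order [tuple scaled i | i < n + 1]).
Proof.
apply: leq_tuple_order => i m; rewrite tnth_mktuple /scaled /blocks.
case: split => j; last by rewrite -mpolyC0 msupp0.
rewrite mulrC mpolyXn (perm_mem (msuppMX _ _)) => /mapP[m' _ ->].
by rewrite mdegD mdegMn mdeg1.
Qed.

(** The Jacobian matrix of the pencil of (T^2 H, 0) is block triangular, and its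
    main block is that of the pencil of H at t T^2. *)
Lemma det_scaled : \det (jac_z (pencil H)) = 1 -> \det (jac_z (pencil scaled)) = 1.
Proof.
move=> h1; rewrite -(submxK (jac_z (pencil scaled))).
have -> : dlsubmx (jac_z (pencil scaled)) = 0.
  apply/matrixP => i j; rewrite 2![in LHS]mxE jac_z_pencil /scaled blocksr mxE.
  by rewrite eq_rlshift /= mderiv0 polyC0 mulr0 subr0.
have -> : drsubmx (jac_z (pencil scaled)) = 1%:M.
  apply/matrixP => i j; rewrite 2![in LHS]mxE jac_z_pencil /scaled blocksr mxE.
  by rewrite /= mderiv0 polyC0 mulr0 subr0 !ord1 !eqxx.
rewrite det_ublock det1 mulr1.
pose psi : R -> {poly MM} :=
  ztsubst (cstR (n + 1) K) (fun i => ('X_(lshift 1 i))%:P) ('X * (T ^+ 2)%:P).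
have -> : ulsubmx (jac_z (pencil scaled)) = map_mx psi (jac_z (pencil H)).
  apply/matrixP => i j; rewrite 2![in LHS]mxE [RHS]mxE !jac_z_pencil /scaled blocksl.
  rewrite mderivM !mderivX_exp mderivXU eq_rlshift mulr0 mul0rn mul0r add0r.
  rewrite mderiv_widenl (inj_eq (@lshift_inj _ _)) polyCM mulrA.
  rewrite /psi ztsubst_pencil_entry; congr (_ - _ * _).
  by rewrite /widenl rmorph_mmap.
by rewrite det_map_mx h1 rmorph1.
Qed.

(** The second component of z - (T^2 H, 0) is T itself, so its inverse can be
    restricted to T = 1. *)
Lemma inverse_scaled G :
  inverse_pair (fun i => 'X_i - scaled i) G -> exists G', inverse_pair (fun i => 'X_i - H i) G'.
Proof.
move=> [h1 h2].
pose tau : MM -> {mpoly K[n]} := mmap (@mpolyC n K) (blocks (fun j => 'X_j) (fun=> 1)).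
have tauC c : tau c%:MP = c%:MP by rewrite /tau mmapC.
have hT : G (rshift n ord0) = T.
  by have := h1 (rshift n ord0); rewrite /scaled blocksr subr0 mmapXU.
exists (fun i => tau (G (lshift 1 i))); split=> i.
  have := h1 (lshift 1 i); rewrite /scaled blocksl rmorphB /=.
  rewrite [mmap _ _ (_ * _)]rmorphM rmorphXn /= !mmapXU hT mmap_widenl.
  have tauB p q : tau (p - T ^+ 2 * q) = tau p - tau T ^+ 2 * tau q.
    by rewrite /tau rmorphB /= rmorphM /= rmorphXn.
  move=> /(congr1 tau); rewrite tauB {2 4}/tau !mmapXU blocksl blocksr expr1n mul1r.
  move=> e; rewrite -[RHS]e.
  rewrite rmorphB /= mmapXU; congr (_ - _).
  by rewrite [in RHS]/tau rmorph_mmap; apply: eq_mmap => // c; exact: esym (tauC c).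
have := congr1 tau (h2 (lshift 1 i)).
rewrite {2}/tau mmapXU blocksl => <-.
rewrite /tau !rmorph_mmap; apply: eq_mmap => [c|] /=; first by rewrite !mmapC.
apply: blocksP => j /=.
  rewrite blocksl mmapXU rmorphB /= mmapXU blocksl /scaled blocksl.
  rewrite rmorphM rmorphXn /= mmapXU blocksr expr1n mul1r mmap_widenl.
  congr (_ - _); rewrite -[LHS]mmap_id; apply: eq_mmap => // k /=.
  by rewrite blocksl.
by rewrite blocksr rmorph1 /scaled blocksr subr0 mmapXU blocksr.
Qed.
End Quadratic.

Lemma sum_mulmx1 (K : fieldType) (V : lmodType K) n (A B : 'M[K]_n) (v : 'I_n -> V) i :
  A *m B = 1%:M -> \sum_k A i k *: (\sum_j B k j *: v j) = v i.
Proof.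
move=> /matrixP AB; under eq_bigr do rewrite scaler_sumr.
rewrite exchange_big /=.
under eq_bigr do (under eq_bigr do rewrite scalerA).
have AB' j : \sum_k A i k * B k j = (i == j)%:R by have := AB i j; rewrite !mxE.
under eq_bigr do rewrite -scaler_suml AB'.
rewrite (bigD1 i) //= eqxx scale1r big1 ?addr0 // => j.
by rewrite eq_sym => /negbTE ->; rewrite scale0r.
Qed.

Section DegreeReduction.
Context (K : fieldType).

Hypothesis linear_case : forall n (H : 'I_n -> {mpoly K[n]}),
  \det (jac_z (pencil H)) = 1 -> exists G, inverse_pair (fun i => 'X_i - H i) G.

Section Step.
Context (n k : nat) (F : 'I_n -> {poly {mpoly K[n]}}).
Hypothesis sizeF : forall i, (size (F i) <= k.+3)%N.
Hypothesis F0 : forall i, (F i)`_0 = 'X_i.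
Local Notation MM := {mpoly K[n + n]}.

Let low i := take_poly k.+2 (F i).
Let top i := (F i)`_(k.+2).
Let y i : MM := 'X_(rshift n i).
Let rho : {poly {mpoly K[n]}} -> {poly MM} := map_poly (widenl n).

(** Adding t^(k+1) times the second block to the first restores F: the two signs
    are chosen so that y cancels. *)
Definition split_top : 'I_(n + n) -> {poly MM} :=
  blocks (fun i => rho (low i) - 'X^(k.+1) * (y i)%:P)
         (fun i => (y i)%:P + 'X * (widenl n (top i))%:P).

Lemma low_top i : F i = low i + (top i)%:P * 'X^(k.+2).
Proof.
apply/polyP => j; rewrite coefD coef_take_poly coefMXn coefC.
case: (ltngtP j k.+2) => [_|jk|->]; rewrite ?addr0 ?add0r ?subnn //.
by rewrite subn_eq0 leqNgt jk /= nth_default // (leq_trans (sizeF i)).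
Qed.

Lemma size_split_top i : (size (split_top i) <= k.+2)%N.
Proof.
rewrite /split_top /blocks; case: split => j.
  rewrite (leq_trans (size_polyD _ _)) // geq_max; apply/andP; split.
    by rewrite (leq_trans (size_poly _ _)) // size_take_poly.
  rewrite size_polyN mulrC (leq_trans (size_polyMleq _ _)) // size_polyXn.
  by rewrite addnS /= -[k.+2]add1n leq_add2r size_polyC_leq1.
rewrite (leq_trans (size_polyD _ _)) // geq_max; apply/andP; split.
  by rewrite (leq_trans (size_polyC_leq1 _)).
rewrite (leq_trans (size_polyMleq _ _)) // size_polyX add2n /=.
by rewrite ltnS (leq_trans (size_polyC_leq1 _)).
Qed.

Lemma split_top0 i : (split_top i)`_0 = 'X_i.
Proof.
rewrite /split_top; move: i; apply: blocksP => j.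
  rewrite blocksl coefB coefXnM subr0 coef_map coef_take_poly /= F0.
  by rewrite /widenl mmapXU.
by rewrite blocksr coefD coefC mulrC coefMX addr0.
Qed.

Lemma dz_rhol j p : dz (lshift n j) (rho p) = rho (dz j p).
Proof. by apply/polyP => l; rewrite coef_dz !coef_map /= mderiv_widenl. Qed.

Lemma dz_rhor j p : dz (rshift n j) (rho p) = 0.
Proof. by apply/polyP => l; rewrite coef_dz coef_map coef0 /= mderivr_widenl. Qed.

(** The addition of t^(k+1) times the second block to the first is left
    multiplication of the Jacobian matrix by a unipotent block matrix. *)
Lemma det_split_top : \det (jac_z F) = 1 -> \det (jac_z split_top) = 1.
Proof.
move=> h1.
pose U : 'M[{poly MM}]_(n + n) := block_mx 1%:M ('X^(k.+1))%:M 0 1%:M.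
have detU : \det U = 1 by rewrite det_ublock !det1 mulr1.
rewrite -[LHS]mul1r -[X in X * _]detU -det_mulmx.
have -> : jac_z split_top = block_mx (map_mx rho (\matrix_(i, j) dz j (low i)))
   (- ('X^(k.+1))%:M) ('X *: map_mx rho (\matrix_(i, j) dz j ((top i)%:P))) 1%:M.
  rewrite -[LHS]submxK; congr block_mx; apply/matrixP => i j; rewrite !mxE.
  - rewrite /split_top blocksl raddfB /= dz_rhol dzM dzXn dzC mderivXU eq_rlshift.
    by rewrite polyC0 mul0r mulr0 addr0 subr0.
  - rewrite /split_top blocksl raddfB /= dz_rhor dzM dzXn dzC mderivXU.
    rewrite (inj_eq (@rshift_inj _ _)) mul0r !add0r.
    by rewrite rmorph_nat mulr_natr.
  - rewrite /split_top blocksr raddfD /= dzM dzX !dzC mderivXU eq_rlshift.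
    by rewrite polyC0 mul0r !add0r mderiv_widenl /rho map_polyC.
  - rewrite /split_top blocksr raddfD /= dzM dzX !dzC mderivXU mderivr_widenl.
    by rewrite (inj_eq (@rshift_inj _ _)) polyC0 mul0r mulr0 !addr0 rmorph_nat.
rewrite mulmx_block !mul1mx !mul0mx !add0r.
rewrite mulmx1 addNr det_lblock det1 mulr1 mul_scalar_mx scalerA.
have -> : map_mx rho (\matrix_(i, j) dz j (low i)) +
     ('X^(k.+1) * 'X) *: map_mx rho (\matrix_(i, j) dz j (top i)%:P) = map_mx rho (jac_z F).
  apply/matrixP => i j; rewrite !mxE [in RHS](low_top i) raddfD /= dzM dzXn mulr0 addr0.
  by rewrite [RHS]rmorphD [X in _ = _ + X]rmorphM /= map_polyXn mulrC -exprSr.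
by rewrite det_map_mx h1 rmorph1.
Qed.

(** The sum of the two blocks at t = 1 is F(z), so the z-part of the inverse
    restricted to y = 0 is a right inverse of F.  It is a left inverse because the
    point (z, - top(z)) is mapped to (F(z), 0). *)
Lemma inverse_split_top G :
  inverse_pair (fun i => (split_top i).[1]) G ->
  exists G', inverse_pair (fun i => (F i).[1]) G'.
Proof.
have rho1 p : (rho p).[1] = widenl n p.[1] by rewrite -(rmorph1 (widenl n)) horner_map.
have Fl i : (split_top (lshift n i)).[1] = widenl n (low i).[1] - y i.
  by rewrite /split_top blocksl hornerD hornerN hornerM hornerXn hornerC expr1n mul1r rho1.
have Fr i : (split_top (rshift n i)).[1] = y i + widenl n (top i).
  by rewrite /split_top blocksr hornerD hornerM hornerX !hornerC mul1r.
have F1 i : (F i).[1] = (low i).[1] + top i.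
  by rewrite {1}low_top hornerD hornerM hornerC hornerXn expr1n mulr1.
move=> [h1 h2].
pose tau : MM -> {mpoly K[n]} := mmap (@mpolyC n K) (blocks (fun j => 'X_j) (fun=> 0)).
pose sigma : MM -> {mpoly K[n]} :=
  mmap (@mpolyC n K) (blocks (fun j => 'X_j) (fun j => - top j)).
exists (fun i => tau (G (lshift n i))); split=> i.
  have := congr2 +%R (h1 (lshift n i)) (h1 (rshift n i)).
  rewrite Fl Fr -rmorphD /= addrA subrK -rmorphD /= -F1 mmap_widenl.
  have tauxy : tau ('X_(lshift n i) + 'X_(rshift n i)) = 'X_i.
    by rewrite /tau rmorphD /= !mmapXU blocksl blocksr addr0.
  move=> /(congr1 tau); rewrite tauxy => <-.
  by rewrite [in RHS]/tau rmorph_mmap; apply: eq_mmap => // c; rewrite [RHS]mmapC.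
(* sigma evaluates at the points (z, - top z), which are sent to (F z, 0). *)
have := congr1 sigma (h2 (lshift n i)).
rewrite {2}/sigma mmapXU blocksl => <-.
rewrite /tau /sigma !rmorph_mmap; apply: eq_mmap => [c|] /=; first by rewrite !mmapC.
have sw b u : mmap (@mpolyC n K) (blocks (fun j => 'X_j) b) (widenl n u) = u.
  rewrite mmap_widenl -[RHS]mmap_id; apply: eq_mmap => // k' /=.
  by rewrite blocksl.
apply: blocksP => j /=.
  by rewrite blocksl mmapXU Fl rmorphB /= sw mmapXU blocksr opprK F1.
by rewrite blocksr rmorph0 Fr rmorphD /= sw mmapXU blocksr addNr.
Qed.
End Step.

Lemma degree_reduction k n (F : 'I_n -> {poly {mpoly K[n]}}) :
  (forall i, size (F i) <= k.+2)%N -> (forall i, (F i)`_0 = 'X_i) ->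
  \det (jac_z F) = 1 -> exists G, inverse_pair (fun i => (F i).[1]) G.
Proof.
elim: k n F => [|k IH] n F hs h0 hd; last first.
  have [|||G hG] := IH _ (split_top k F).
  - exact: size_split_top.
  - exact: split_top0.
  - exact: det_split_top.
  exact: inverse_split_top hG.
have eF i : F i = pencil (fun i => - (F i)`_1) i.
  have -> : pencil (fun i => - (F i)`_1) i = ('X_i : {mpoly K[n]})%:P + ((F i)`_1)%:P * 'X.
    by rewrite /pencil polyCN mulrN opprK [in RHS]mulrC.
  apply/polyP => l; rewrite coefD coefC coefMX; case: l => [|l].
    by rewrite eqxx addr0 h0.
  rewrite [l.+1 == 0%N]/= add0r coefC; case: l => [|l] //.
  by rewrite nth_default // (leq_trans (hs i)).
have [|G hG] := linear_case (H := fun i => - (F i)`_1).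
  by rewrite -hd; congr (\det _); apply/matrixP => i j; rewrite !mxE -eF.
exists G; apply: eq_inverse_pair hG => i.
by rewrite [in RHS]eF /pencil hornerD hornerN hornerM hornerX !hornerC mul1r.
Qed.

Section Normalization.
Context (n : nat) (F : n.-tuple {mpoly K[n]}).
Hypothesis detF : \det (jacobian F) = 1.
Local Notation M := {mpoly K[n]}.
Local Notation R := {poly {mpoly K[n]}}.

Let at0 : M -> K := meval (fun=> 0).
Let dilate : M -> R := zsubst (fun i => ('X_i)%:P * 'X).
Let F_t i := dilate (tnth F i).
Let b i : K := at0 (tnth F i).
(** The family (F(tz) - F(0)) / t, written with a truncation instead of a
    division. *)
Let Q i := drop_poly 1 (F_t i).
Let A : 'M[K]_n := map_mx at0 (jacobian F).

Lemma dilate0 u : (dilate u)`_0 = (at0 u)%:MP.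
Proof.
rewrite -horner_coef0 -/(horner_eval 0 _) /dilate /zsubst rmorph_mmap.
rewrite /at0 /meval rmorph_mmap; apply: eq_mmap => [c|i] /=.
  by rewrite /horner_eval hornerC.
by rewrite /horner_eval hornerM hornerX mulr0 mpolyC0.
Qed.

Lemma dilate1 u : (dilate u).[1] = u.
Proof.
rewrite -/(horner_eval 1 _) /dilate /zsubst rmorph_mmap -[RHS]mmap_id.
apply: eq_mmap => [c|i] /=; first by rewrite /horner_eval hornerC.
by rewrite /horner_eval hornerM hornerX hornerC mulr1.
Qed.

Lemma F_tE i : F_t i = ((b i)%:MP)%:P + Q i * 'X.
Proof.
apply/polyP => -[|j]; rewrite coefD coefC coefMX /= ?addr0 ?add0r ?dilate0 //.
by rewrite coef_drop_poly addn1.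
Qed.

Lemma coef0_Q i : (Q i)`_0 = \sum_j A i j *: 'X_j.
Proof.
rewrite coef_drop_poly -[(F_t i)`_1]mulr1n -(coef_deriv (F_t i) 0).
rewrite (derivation_mmap (D := deriv) (@derivM _)) => [|c]; last exact: derivC.
rewrite coef_sum; apply: eq_bigr => j _ /=.
rewrite derivM derivC derivX mul0r mulr1 add0r mulrC -[_ * mmap _ _ _]/(_ * dilate _).
by rewrite coefCM dilate0 mulrC mul_mpolyC !mxE.
Qed.

Lemma Q_at1 i : (Q i).[1] = tnth F i - (b i)%:MP.
Proof.
have := congr1 (horner^~ 1) (F_tE i).
by rewrite dilate1 hornerD hornerM hornerX hornerC mulr1 => ->; rewrite addrAC subrr add0r.
Qed.

Lemma det_jac_z_Q : \det (jac_z Q) = 1.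
Proof.
have -> : jac_z Q = map_mx dilate (jacobian F).
  apply/matrixP => i j; rewrite !mxE; apply: (mulIf (negbT (polyX_eq0 _))).
  have := congr1 (dz j) (F_tE i).
  rewrite raddfD /= dzC mderivC polyC0 add0r dzM dzX mulr0 addr0 => <-.
  rewrite /F_t /dilate dz_zsubst (bigD1 j) //= big1 => [|k nkj].
    by rewrite dzM dzX dzC mderivXU eqxx mulr0 !addr0 mul1r.
  by rewrite dzM dzX dzC mderivXU (negbTE nkj) polyC0 mul0r add0r !mulr0.
by rewrite det_map_mx detF rmorph1.
Qed.

Lemma detA : \det A = 1.
Proof. by rewrite /A det_map_mx detF rmorph1. Qed.

Lemma unitA : A \in unitmx. Proof. by rewrite unitmxE detA unitr1. Qed.

Let B := invmx A.

Let Phi i : R := \sum_j (B i j)%:MP%:P * Q j.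

Lemma coef0_Phi i : (Phi i)`_0 = 'X_i.
Proof.
rewrite coef_sum.
under eq_bigr do rewrite coefCM coef0_Q mul_mpolyC.
by apply: sum_mulmx1; apply: mulVmx unitA.
Qed.

Lemma det_jac_z_Phi : \det (jac_z Phi) = 1.
Proof.
have -> : jac_z Phi = map_mx (cstR n K) B *m jac_z Q.
  apply/matrixP => i j; rewrite !mxE raddf_sum; apply: eq_bigr => k _ /=.
  by rewrite dzM dzC mderivC polyC0 mul0r add0r !mxE.
by rewrite det_mulmx det_map_mx det_jac_z_Q mulr1 det_inv detA invr1 rmorph1.
Qed.

(** Here Phi at t = 1 is A^-1 (F - b), with b = F(0) and A = dF/dz(0), so
    F = b + A Phi and its inverse is that of Phi at A^-1 (z - b). *)
Lemma keller_inverse : exists G, inverse_pair (tnth F) G.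
Proof.
have [|G [h1 h2]] := degree_reduction (k := \max_i size (Phi i)) _ coef0_Phi det_jac_z_Phi.
  move=> i; apply: (@leq_trans (\max_i size (Phi i))); last exact: leq_addl 2 _.
  exact: (leq_bigmax (F := fun i => size (Phi i))).
have Phi1 i : (Phi i).[1] = \sum_j B i j *: (tnth F j - (b j)%:MP).
  rewrite horner_sum; apply: eq_bigr => j _.
  by rewrite hornerM hornerC Q_at1 mul_mpolyC.
have FPhi i : tnth F i = (b i)%:MP + \sum_k A i k *: (Phi k).[1].
  under eq_bigr do rewrite Phi1.
  by rewrite (sum_mulmx1 _ _ (mulmxV unitA)) [RHS]addrC subrK.
pose w i : M := \sum_j B i j *: ('X_j - (b j)%:MP).
exists (fun i => mmap (@mpolyC n K) w (G i)); split=> i.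
  have -> : mmap (@mpolyC n K) (fun i => mmap (@mpolyC n K) w (G i)) (tnth F i) =
      mmap (@mpolyC n K) w (mmap (@mpolyC n K) G (tnth F i)).
    by rewrite [RHS]rmorph_mmap; apply: eq_mmap => // c /=; rewrite mmapC.
  have Gi : mmap (@mpolyC n K) G (tnth F i) = (b i)%:MP + \sum_k A i k *: 'X_k.
    rewrite FPhi rmorphD /= mmapC; congr (_ + _); rewrite raddf_sum; apply: eq_bigr => k _ /=.
    by rewrite mmapZ h1 mul_mpolyC.
  rewrite Gi rmorphD /= mmapC [mmap _ _ (\sum_k _)]raddf_sum /=.
  under eq_bigr do rewrite mmapZ mmapXU mul_mpolyC.
  by rewrite (sum_mulmx1 _ _ (mulmxV unitA)) [LHS]addrC subrK.
rewrite rmorph_mmap -h2; apply: eq_mmap => [c|j] /=; first by rewrite mmapC.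
rewrite Phi1 raddf_sum; apply: eq_bigr => l _ /=.
by rewrite mmapZ mul_mpolyC rmorphB /= mmapXU mmapC.
Qed.
End Normalization.
End DegreeReduction.

(** * The equivalence *)

Lemma eq_iterdiv (n : nat) (K : fieldType) (H H' : 'I_n -> {mpoly K[n]}) m u :
  H =1 H' -> iterdiv H m u = iterdiv H' m u.
Proof.
move=> e; elim: m u => [//|m IH] u /=.
by apply: eq_bigr => i _; rewrite IH e.
Qed.

Theorem theorem4p6 (K : fieldType) (charK : [pchar K] =i pred0) :
  (forall n : nat, (1 <= n)%N ->
     forall F : n.-tuple {mpoly K[n]},
       \det (jacobian F) = 1 -> polymap_automorphism F)
  <->
  (forall n : nat, (1 <= n)%N ->
     forall H : n.-tuple {mpoly K[n]},
       leq_xnat 2 (tuple_order H) ->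
       (forall m : nat, (1 <= m)%N -> iter m Lambda (xi_pairing H ^+ m) = 0) ->
       exists N : nat, forall m : nat, (N <= m)%N ->
         iter m Lambda (xi_pairing H ^+ m.+1) = 0).
Proof.
split=> [JC n _ H _ hL | VC n _ F detF].
  have hdet : \det (jac_z (pencil (tnth H))) = 1.
    by apply: (det_pencil_eq1 charK) => m /hL /(Lambda_power_eq0 _ charK _).
  have [g hg] := jacobian_conjecture_flow (JC (n + 1)%N (leq_addl _ _)) hdet.
  have [N hN] := flow_vanishing hdet hg.
  by exists N => m /hN /(Lambda_powerS_eq0 _ charK _).
apply/polymap_automorphismP; apply: (keller_inverse _ detF) => l H hdet.
have hdet2 := det_scaled hdet.
pose S := [tuple scaled H i | i < l + 1].
have eS : tnth S =1 scaled H by move=> i; rewrite tnth_mktuple.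
have [m m1|N hN] := VC (l + 1)%N (leq_addl _ _) S (order_scaled H).
  apply/(Lambda_power_eq0 _ charK _); rewrite (eq_iterdiv _ _ eS).
  exact: iterdiv1_eq0 hdet2 m1.
have [|g hg] := flow_polynomial charK (k := N) hdet2.
  move=> m /hN /(Lambda_powerS_eq0 _ charK _) h j.
  by have := h j; rewrite (eq_iterdiv _ _ eS) eS.
exact: inverse_scaled (flow_inverse hg).
Qed.
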